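(* Let $M$ be a locally left Gaussian monoid admitting a linearly ordered set of generators $(\mathcal X,<)$, where $1\notin\mathcal X$ and, for every $x\in M$, the set of right divisors of $x$ lying in $\mathcal X$ is well-ordered by $<$. Suppose that $n$ is the maximal size of an increasing sequence $(\alpha_1,\ldots,\alpha_n)$ in $\mathcal X$ such that the left lcm $\alpha_1\vee\cdots\vee\alpha_n$ exists and, for each $i$, $\alpha_i$ is the $<$-least right divisor of $\alpha_i\vee\cdots\vee\alpha_n$ lying in $\mathcal X$. Then $\mathbb{Z}$ admits a finite free resolution of length $n$ over $\mathbb{Z}M$; so, in particular, $M$ is of type $FL$.
   Context: For $x,y$ in a monoid $M$, $x$ is a proper left divisor of $y$ if $y=xz$ for some $z\ne1$. If $y=zx$ for some $z$, then $x$ is a right divisor of $y$ and $y$ is a left multiple of $x$. The monoid $M$ is locally left Gaussian if it is right cancellative ($xz=yz$ implies $x=y$), there is no infinite sequence $x_1,x_2,\ldots$ in which each $x_{i+1}$ is a proper left divisor of $x_i$, and any two elements that admit a common left multiple admit a left lcm (a common left multiple of which every common left multiple is a left multiple). The symbol $\vee$ denotes the left lcm. $\mathbb{Z}$ is regarded as a trivial $\mathbb{Z}M$-module ($x\cdot 1=1$ for every $x\in M$). $M$ is said to be of type $FL$ if $\mathbb{Z}$ admits a finite free resolution over $\mathbb{Z}M$.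
   Formalization: With finitely generated modules the claim fails (free monoid on an infinite set, n=1), so the resolution of length n and type FL are proved with free modules of any rank, and with finite ranks when only finitely many such sequences (α_1,…,α_k) exist, e.g. when 𝒳 is finite. *)

(* Defs.v *)
From HB Require Import structures.
From mathcomp Require Import all_boot all_order all_algebra finmap.
From mathcomp Require Import monalg.

Set Implicit Arguments.
Unset Strict Implicit.
Unset Printing Implicit Defensive.

Import GRing.Theory.

Local Open Scope fset_scope.
Local Open Scope ring_scope.

(* The ring structure that the library puts on [{malg int[K]}] asks for a
   [monomType], whose axioms include [x * y = 1 -> x = 1 /\ y = 1]. The ring ZM
   is built here for an arbitrary monoid, with the same convolution product. *)
Definition monoid_ring (M : monoidType) : Type := {malg int[M]}.

HB.instance Definition _ (M : monoidType) :=
  GRing.Zmodule.copy (monoid_ring M) {malg int[M]}.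

Section MonoidRing.
Variable M : monoidType.
Implicit Types (g : monoid_ring M) (x y : M) (c : int).

Definition mr_of x : monoid_ring M := << 1 *g x >>.

Definition mr_one : monoid_ring M := mr_of 1%g.

Definition mr_mul g1 g2 : monoid_ring M :=
  \sum_(x <- msupp g1) \sum_(y <- msupp g2) << g1@_x * g2@_y *g (x * y)%g >>.

Let mr_mulw (d1 d2 : {fset M}) g1 g2 :
  msupp g1 `<=` d1 -> msupp g2 `<=` d2 ->
  mr_mul g1 g2 =
    \sum_(x <- d1) \sum_(y <- d2) << g1@_x * g2@_y *g (x * y)%g >>.
Proof.
move=> le1 le2; rewrite /mr_mul (big_fset_incl _ le1) /=.
  apply/eq_bigr=> x _; apply/big_fset_incl => // y _ /mcoeff_outdom ->.
  by rewrite mulr0 monalgU0.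
move=> x _ /mcoeff_outdom g1x.
by rewrite big1 // => y _; rewrite g1x mul0r monalgU0.
Qed.

Let mr_mulDl : left_distributive mr_mul +%R.
Proof.
move=> g1 g2 g; pose d := msupp g1 `|` msupp g2.
rewrite (@mr_mulw d (msupp g) g1) ?fsubsetUl //.
rewrite (@mr_mulw d (msupp g) g2) ?fsubsetUr //.
rewrite (@mr_mulw d (msupp g) (g1 + g2)) ?msuppD_le //.
rewrite -big_split /=; apply/eq_bigr=> x _.
rewrite -big_split /=; apply/eq_bigr=> y _.
by rewrite mcoeffD mulrDl monalgUD.
Qed.

Let mr_mulDr : right_distributive mr_mul +%R.
Proof.
move=> g g1 g2; pose d := msupp g1 `|` msupp g2.
rewrite (@mr_mulw (msupp g) d g g1) ?fsubsetUl //.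
rewrite (@mr_mulw (msupp g) d g g2) ?fsubsetUr //.
rewrite (@mr_mulw (msupp g) d g (g1 + g2)) ?msuppD_le //.
rewrite -big_split /=; apply/eq_bigr=> x _.
rewrite -big_split /=; apply/eq_bigr=> y _.
by rewrite mcoeffD mulrDr monalgUD.
Qed.

Let mr_mul0g g : mr_mul 0 g = 0.
Proof. by rewrite /mr_mul msupp0 big_seq_fset0. Qed.

Let mr_mulg0 g : mr_mul g 0 = 0.
Proof. by rewrite /mr_mul msupp0 big1 // => x _; rewrite big_seq_fset0. Qed.

Let mr_mulUU c1 c2 x y :
  mr_mul << c1 *g x >> << c2 *g y >> = << c1 * c2 *g (x * y)%g >>.
Proof.
by rewrite (mr_mulw msuppU_le msuppU_le) !big_seq_fset1 !mcoeffUU.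
Qed.

Let mr_ind (P : monoid_ring M -> Prop) :
  P 0 -> (forall c x, P << c *g x >>) ->
  (forall g1 g2, P g1 -> P g2 -> P (g1 + g2)) -> forall g, P g.
Proof. by move=> P0 PU PD g; rewrite [g]monalgE; apply: big_ind. Qed.

Let mr_mulA : associative mr_mul.
Proof.
move=> g1 g2 g3; elim/mr_ind: g1 => [|c1 x|g g' IH IH'].
- by rewrite !mr_mul0g.
- elim/mr_ind: g2 => [|c2 y|g g' IH IH'].
  + by rewrite mr_mulg0 !mr_mul0g mr_mulg0.
  + elim/mr_ind: g3 => [|c3 z|g g' IH IH'].
    * by rewrite !mr_mulg0.
    * by rewrite !mr_mulUU mulrA mulgA.
    * by rewrite !mr_mulDr IH IH'.
  + by rewrite mr_mulDr !mr_mulDl mr_mulDr IH IH'.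
- by rewrite !mr_mulDl IH IH'.
Qed.

Let mr_mul1g : left_id mr_one mr_mul.
Proof.
elim/mr_ind=> [|c x|g g' IH IH']; first exact: mr_mulg0.
  by rewrite mr_mulUU mul1r mul1g.
by rewrite mr_mulDr IH IH'.
Qed.

Let mr_mulg1 : right_id mr_one mr_mul.
Proof.
elim/mr_ind=> [|c x|g g' IH IH']; first exact: mr_mul0g.
  by rewrite mr_mulUU mulr1 mulg1.
by rewrite mr_mulDl IH IH'.
Qed.

Let mr_one_neq0 : mr_one != 0.
Proof. by rewrite /mr_one /mr_of monalgU_eq0. Qed.

HB.instance Definition _ := GRing.Zmodule_isNzRing.Build (monoid_ring M)
  mr_mulA mr_mul1g mr_mulg1 mr_mulDl mr_mulDr mr_one_neq0.

Lemma mr_mulE c1 c2 x y :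
  (<< c1 *g x >> : monoid_ring M) * << c2 *g y >> = << c1 * c2 *g (x * y)%g >>.
Proof. exact: mr_mulUU. Qed.

Lemma mr_ofM x y : mr_of (x * y)%g = mr_of x * mr_of y.
Proof. by rewrite /mr_of mr_mulE mulr1. Qed.

Definition augmentation g : int := \sum_(x <- msupp g) g@_x.

Let augmentationw (d : {fset M}) g :
  msupp g `<=` d -> augmentation g = \sum_(x <- d) g@_x.
Proof.
by move=> le; rewrite /augmentation (big_fset_incl _ le) // => x _ /mcoeff_outdom.
Qed.

Lemma augmentationU c x : augmentation << c *g x >> = c.
Proof. by rewrite (augmentationw msuppU_le) big_seq_fset1 mcoeffUU. Qed.

Lemma augmentationD : {morph augmentation : g1 g2 / g1 + g2}.
Proof.
move=> g1 g2; pose d := msupp g1 `|` msupp g2.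
rewrite (@augmentationw d g1) ?fsubsetUl // (@augmentationw d g2) ?fsubsetUr //.
rewrite (@augmentationw d) ?msuppD_le // -big_split /=.
by apply/eq_bigr=> x _; rewrite mcoeffD.
Qed.

Let augmentation0 : augmentation 0 = 0.
Proof. by rewrite /augmentation msupp0 big_seq_fset0. Qed.

Lemma augmentation1 : augmentation 1 = 1.
Proof. exact: augmentationU. Qed.

Lemma augmentationM : {morph augmentation : g1 g2 / g1 * g2}.
Proof.
move=> g1 g2; elim/mr_ind: g1 => [|c1 x|g g' IH IH'].
- by rewrite mul0r augmentation0 mul0r.
- elim/mr_ind: g2 => [|c2 y|g g' IH IH'].
  + by rewrite mulr0 augmentation0 mulr0.
  + by rewrite mr_mulE !augmentationU.
  + by rewrite mulrDr !augmentationD IH IH' mulrDr.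
- by rewrite mulrDl !augmentationD IH IH' mulrDl.
Qed.

End MonoidRing.

Definition trivial_Z (M : monoidType) : Type := int.

HB.instance Definition _ (M : monoidType) :=
  GRing.Zmodule.copy (trivial_Z M) int.

Section TrivialModule.
Variable M : monoidType.

Definition trivial_scale (g : monoid_ring M) (m : trivial_Z M) : trivial_Z M :=
  augmentation g * (m : int).

Let trivial_scaleA g1 g2 m :
  trivial_scale g1 (trivial_scale g2 m) = trivial_scale (g1 * g2) m.
Proof. by rewrite /trivial_scale augmentationM mulrA. Qed.

Let trivial_scale1 : left_id 1 trivial_scale.
Proof. by move=> m; rewrite /trivial_scale augmentation1 mul1r. Qed.

Let trivial_scaleDr : right_distributive trivial_scale +%R.
Proof. by move=> g m1 m2; rewrite /trivial_scale mulrDr. Qed.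

Let trivial_scaleDl m : {morph trivial_scale^~ m : g1 g2 / g1 + g2}.
Proof. by move=> g1 g2; rewrite /trivial_scale augmentationD mulrDl. Qed.

HB.instance Definition _ :=
  GRing.Zmodule_isLmodule.Build (monoid_ring M) (trivial_Z M)
    trivial_scaleA trivial_scale1 trivial_scaleDr trivial_scaleDl.

Lemma trivial_ZE (x : M) (m : trivial_Z M) : mr_of x *: m = m.
Proof. by rewrite /GRing.scale /= /trivial_scale augmentationU mul1r. Qed.

End TrivialModule.

Definition is_basis (R : nzRingType) (V : lmodType R) (B : V -> Prop) : Prop :=
  (forall v : V, exists (s : seq V) (c : V -> R),
     (forall b, b \in s -> B b) /\ v = \sum_(b <- s) c b *: b) /\
  (forall (s : seq V) (c : V -> R),
     uniq s -> (forall b, b \in s -> B b) ->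
     \sum_(b <- s) c b *: b = 0 -> forall b, b \in s -> c b = 0).

Definition is_free (R : nzRingType) (V : lmodType R) : Prop :=
  exists B : V -> Prop, is_basis B.

Definition is_fg_free (R : nzRingType) (V : lmodType R) : Prop :=
  exists bs : seq V, is_basis (fun b : V => b \in bs).

(* [0 -> C n -> ... -> C 0 -> Z -> 0] is exact, where every [C k] with [k <= n]
   satisfies [P]; the sequence is continued by zero modules beyond [n]. *)
Definition Z_resolution (M : monoidType)
    (P : lmodType (monoid_ring M) -> Prop) (n : nat) : Prop :=
  exists (C : nat -> lmodType (monoid_ring M))
         (d : forall k, {linear C k.+1 -> C k})
         (e : {linear C 0%N -> trivial_Z M}),
    [/\ forall k, (k <= n)%N -> P (C k),
        forall k, (n < k)%N -> forall v : C k, v = 0,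
        forall m : trivial_Z M, exists v : C 0%N, e v = m,
        forall v : C 0%N, e v = 0 <-> exists w : C 1%N, d 0%N w = v
      & forall k (v : C k.+1), d k v = 0 <-> exists w : C k.+2, d k.+1 w = v].

(* In [free_resolution] only the length is finite, the ranks being arbitrary; in
   [fg_free_resolution] the ranks are finite too. The second is not available
   for an infinite set of generators in general: for the free monoid on an
   infinite set, the augmentation ideal is free of infinite rank. *)
Definition free_resolution (M : monoidType) (n : nat) : Prop :=
  Z_resolution (@is_free (monoid_ring M)) n.

Definition fg_free_resolution (M : monoidType) (n : nat) : Prop :=
  Z_resolution (@is_fg_free (monoid_ring M)) n.

Definition type_FL (M : monoidType) : Prop :=
  exists n, free_resolution M n.

Definition type_FL_fg (M : monoidType) : Prop :=
  exists n, fg_free_resolution M n.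

Section Divisibility.
Variable M : monoidType.
Implicit Types (x y z m a : M) (s : seq M) (X : M -> Prop).
Implicit Types lt : M -> M -> Prop.

Definition proper_left_divisor x y : Prop :=
  exists z, z <> 1%g /\ y = (x * z)%g.

Definition right_divisor x y : Prop := exists z, y = (z * x)%g.

Definition left_multiple y x : Prop := right_divisor x y.

Definition common_left_multiple s m : Prop :=
  forall x, x \in s -> left_multiple m x.

Definition is_left_lcm s m : Prop :=
  common_left_multiple s m /\
  forall m', common_left_multiple s m' -> left_multiple m' m.

Definition locally_left_Gaussian : Prop :=
  [/\ forall x y z, (x * z = y * z)%g -> x = y,
      ~ exists x : nat -> M, forall i, proper_left_divisor (x i.+1) (x i)
    & forall x y, (exists m, common_left_multiple [:: x; y] m) ->
        exists m, is_left_lcm [:: x; y] m].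

Definition generates X : Prop :=
  forall x, exists s, (forall y, y \in s -> X y) /\ x = (\prod_(y <- s) y)%g.

Definition linear_order_on X lt : Prop :=
  [/\ forall x, X x -> ~ lt x x,
      forall x y z, X x -> X y -> X z -> lt x y -> lt y z -> lt x z
    & forall x y, X x -> X y -> [\/ lt x y, x = y | lt y x]].

Definition is_least lt (A : M -> Prop) a : Prop :=
  A a /\ forall b, A b -> b = a \/ lt a b.

Definition well_ordered_by lt (A : M -> Prop) : Prop :=
  forall B : M -> Prop, (forall b, B b -> A b) -> (exists b, B b) ->
    exists a, is_least lt B a.

Definition right_divisors_in X x : M -> Prop :=
  fun a => X a /\ right_divisor a x.

(* The sequence [s] is [:: alpha_1; ...; alpha_n], and [drop i s] runs over its
   nonempty suffixes. *)
Definition admissible X lt s : Prop :=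
  [/\ forall x, x \in s -> X x,
      forall i j, (i < j < size s)%N -> lt (nth 1%g s i) (nth 1%g s j),
      exists m, is_left_lcm s m
    & forall i, (i < size s)%N ->
        exists m, is_left_lcm (drop i s) m /\
                  is_least lt (right_divisors_in X m) (nth 1%g s i)].

Definition is_max_size (A : seq M -> Prop) (n : nat) : Prop :=
  (exists s, A s /\ size s = n) /\ forall s, A s -> (size s <= n)%N.

Definition finitely_many (A : seq M -> Prop) : Prop :=
  exists ss : seq (seq M), forall s, A s -> s \in ss.

End Divisibility.

(* Main.v *)
(* The complex has the admissible sequences A of length k as basis in degree k.
   Over the integers its chains have the basis x[A], x in M; place x[A] at
   x lcm(A), and order positions by proper left division, which is well founded
   and compatible with left multiplication. Call x[A] irreducible if the head of
   A is the least generator dividing its position on the right (x = 1 if A is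
   empty). If x[A] is reducible and a is the least generator dividing x lcm(A)
   on the right, then a::A is admissible, and this matches the reducible
   k-chains with the irreducible (k+1)-chains y[a::A], x = y q,
   lcm(a::A) = q lcm(A).
   By induction on k, the irreducible k-chains form a complement of ker d_k. So
   d_{k+1}[a::A] can be defined as q[A] - z with z irreducible and
   d_k z = d_k(q[A]). The terms of y z are irreducible or at positions smaller
   than y q[A], so that d_{k+1} from irreducible chains to chains modulo
   irreducible ones is unitriangular along the matching; this gives exactness
   and the induction hypothesis for k+1. *)
Require Import Defs.
From HB Require Import structures.
From mathcomp Require Import all_boot all_order all_algebra finmap.
From mathcomp Require Import boolp monalg.

Set Implicit Arguments.
Unset Strict Implicit.
Unset Printing Implicit Defensive.

Import GRing.Theory.

Local Open Scope ring_scope.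

(** * Bases, and free modules presented by generators and coordinates *)

Lemma is_basis_ext (R : nzRingType) (V : lmodType R) (B B' : V -> Prop) :
  (forall v, B v <-> B' v) -> is_basis B -> is_basis B'.
Proof.
move=> BB' [span indep]; split.
  move=> v; have [s [c [sB ->]]] := span v.
  by exists s, c; split=> // b /sB /BB'.
move=> s c us sB; apply: indep => // b /sB; exact: (BB' b).2.
Qed.

Record free_module (R : nzRingType) (K : choiceType) := FreeModule {
  free_sort : lmodType R;
  free_gen : K -> free_sort;
  free_coord : free_sort -> K -> R;
  free_supp : free_sort -> seq K;
  free_coord_is_linear : forall a v w k,
    free_coord (a *: v + w) k = a * free_coord v k + free_coord w k;
  free_coord_gen : forall k k', free_coord (free_gen k) k' = (k == k')%:R;
  free_coord_inj : forall v w,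
    (forall k, free_coord v k = free_coord w k) -> v = w;
  free_supp_uniq : forall v, uniq (free_supp v);
  mem_free_supp : forall v k, (k \in free_supp v) = (free_coord v k != 0)
}.

(* Opaque on purpose: if [{malg R[K]}] can be unfolded, failing conversion tests
   between module elements blow up. *)
Lemma malg_free_module (R : nzRingType) (K : choiceType) : free_module R K.
Proof.
exists ({malg R[K]} : lmodType R) (fun k => << (1 : R) *g k >>)
  (fun v k => v@_k) (fun v => msupp v).
- by move=> a v w k; rewrite mcoeffD mcoeffZ.
- by move=> k k'; rewrite mcoeffU.
- by move=> v w eq_vw; apply/malgP.
- by move=> v; apply: fset_uniq.
- by move=> v k; rewrite mcoeff_neq0.
Qed.

Definition free_mod (R : nzRingType) (K : choiceType) : lmodType R :=
  free_sort (malg_free_module R K).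

Section FreeModule.
Variables (R : nzRingType) (K : choiceType).
Implicit Types (v w : free_mod R K) (k : K).

Definition gen k : free_mod R K := free_gen _ k.

Definition coord v k : R := free_coord v k.

Definition csupp v : seq K := free_supp v.

Lemma mem_csupp v k : (k \in csupp v) = (coord v k != 0).
Proof. exact: mem_free_supp. Qed.

Lemma csupp_uniq v : uniq (csupp v).
Proof. exact: free_supp_uniq. Qed.

Lemma coordP v w : (forall k, coord v k = coord w k) -> v = w.
Proof. exact: free_coord_inj. Qed.

Lemma coord_gen k k' : coord (gen k) k' = (k == k')%:R.
Proof. exact: free_coord_gen. Qed.

Lemma coordD v w k : coord (v + w) k = coord v k + coord w k.
Proof. by rewrite -[v in LHS]scale1r [LHS]free_coord_is_linear mul1r. Qed.

Lemma coord0 k : coord 0 k = 0.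
Proof. by apply: (addrI (coord 0 k)); rewrite -coordD !addr0. Qed.

Lemma coordZ (a : R) v k : coord (a *: v) k = a * coord v k.
Proof.
by rewrite -[_ *: v]addr0 [LHS]free_coord_is_linear -/(coord 0 k) coord0 addr0.
Qed.

Lemma coordB v w k : coord (v - w) k = coord v k - coord w k.
Proof. by rewrite coordD -scaleN1r coordZ mulN1r. Qed.

Lemma coord_sum (I : Type) (r : seq I) (F : I -> free_mod R K) k :
  coord (\sum_(i <- r) F i) k = \sum_(i <- r) coord (F i) k.
Proof.
by elim/big_rec2: _ => [|i y1 y2 _ <-]; [exact: coord0 | exact: coordD].
Qed.

Lemma sum_gen v (r : seq K) : uniq r -> {subset csupp v <= r} ->
  v = \sum_(k <- r) coord v k *: gen k.
Proof.
move=> ur sub; apply: coordP => k; rewrite coord_sum.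
have [kr|nkr] := boolP (k \in r).
  rewrite (bigD1_seq k) //= coordZ coord_gen eqxx mulr1 big1 ?addr0 // => k' nk.
  by rewrite coordZ coord_gen (negPf nk) mulr0.
have /eqP -> : coord v k == 0.
  by apply: contraNT nkr; rewrite -mem_csupp; apply: sub.
rewrite big_seq big1 // => k' k'r; rewrite coordZ coord_gen.
by have [kk'|_] := eqVneq k' k; [rewrite -kk' k'r in nkr | rewrite mulr0].
Qed.

Lemma csupp_gen k : csupp (gen k) = [:: k].
Proof.
apply: perm_small_eq => //; apply: uniq_perm; rewrite ?csupp_uniq // => k'.
rewrite mem_csupp coord_gen inE (eq_sym k').
by case: (k == k'); rewrite ?oner_eq0 ?eqxx.
Qed.

Lemma gen_basis : is_basis (fun v => exists k, v = gen k).
Proof.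
split.
  move=> v; exists [seq gen k | k <- csupp v].
  (* Coefficients are indexed by vectors but coordinates by generators; since [csupp (gen k)] is
     [[:: k]], summing over [csupp b] recovers the index. *)
  exists (fun b => \sum_(k <- csupp b) coord v k); split.
    by move=> _ /mapP [k _ ->]; exists k.
  rewrite big_map {1}(@sum_gen v (csupp v)) ?csupp_uniq //.
  by apply: eq_bigr => k _; rewrite csupp_gen big_seq1.
move=> s c us sB s0 b bs; have [k bE] := sB b bs.
move/(congr1 (coord^~ k)): s0; rewrite coord_sum coord0 (bigD1_seq b) //=.
rewrite {2}bE coordZ coord_gen eqxx mulr1 big_seq_cond big1 ?addr0 // => b'.
case/andP=> b's; have [k' ->] := sB b' b's; rewrite bE => nb.
rewrite coordZ coord_gen; have [kk'|_] := eqVneq k' k; last by rewrite mulr0.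
by rewrite kk' eqxx in nb.
Qed.

Section Lift.
Variables (V : lmodType R) (f : K -> V).

Definition free_lift v : V := \sum_(k <- csupp v) coord v k *: f k.

(** Terms outside the support vanish. This lets linearity be checked over one list common to all the
    vectors involved. *)
Lemma free_lift_supp v (r : seq K) : uniq r -> {subset csupp v <= r} ->
  free_lift v = \sum_(k <- r) coord v k *: f k.
Proof.
move=> ur sub; rewrite [RHS](bigID [in csupp v]) /= [X in _ + X]big1 ?addr0.
  rewrite -big_filter; apply: perm_big; apply: uniq_perm.
  - exact: csupp_uniq.
  - exact: filter_uniq.
  - move=> k; rewrite mem_filter; have [/sub->//|//] := boolP (k \in csupp v).
by move=> k; rewrite mem_csupp negbK => /eqP->; rewrite scale0r.
Qed.

Lemma free_lift_is_linear : linear free_lift.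
Proof.
move=> a v w; pose r := undup (csupp (a *: v + w) ++ csupp v ++ csupp w).
rewrite !(@free_lift_supp _ r) ?undup_uniq //; last first.
- by move=> k kv; rewrite mem_undup !mem_cat kv.
- by move=> k kv; rewrite mem_undup !mem_cat kv orbT.
- by move=> k kv; rewrite mem_undup !mem_cat kv !orbT.
rewrite scaler_sumr -big_split; apply: eq_bigr => k _ /=.
by rewrite coordD coordZ scalerDl scalerA.
Qed.

HB.instance Definition _ :=
  GRing.isLinear.Build R (free_mod R K) V *:%R free_lift free_lift_is_linear.

Lemma free_lift_gen k : free_lift (gen k) = f k.
Proof. by rewrite /free_lift csupp_gen big_seq1 coord_gen eqxx scale1r. Qed.

End Lift.
End FreeModule.

(** * Integer coefficients of elements of the monoid ring *)

Definition ZM (M : monoidType) : nzRingType := monoid_ring M.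

Section MonoidRingCoefficients.
Variable M : monoidType.
Implicit Types (a b : ZM M) (x y : M).

Definition zmono x : ZM M := mr_of x.

Definition zcoef a x : int := (a : monoid_ring M)@_x.

Definition zsupp a : seq M := msupp (a : monoid_ring M).

Lemma zmonoM x y : zmono (x * y)%g = zmono x * zmono y.
Proof. exact: mr_ofM. Qed.

Lemma zcoef0 x : zcoef 0 x = 0.
Proof. exact: mcoeff0. Qed.

Lemma zcoefB a b x : zcoef (a - b) x = zcoef a x - zcoef b x.
Proof. exact: mcoeffB. Qed.

Lemma zcoef_mono x y : zcoef (zmono x) y = (x == y)%:R.
Proof. exact: mcoeffU. Qed.

Lemma zcoefP a b : (forall x, zcoef a x = zcoef b x) -> a = b.
Proof. by move=> eq_ab; apply/malgP. Qed.

Lemma mem_zsupp a x : (x \in zsupp a) = (zcoef a x != 0).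
Proof. by rewrite /zcoef mcoeff_neq0. Qed.

Lemma sum_zmono a : a = \sum_(x <- zsupp a) zmono x *~ zcoef a x.
Proof.
rewrite [LHS](monalgE (a : monoid_ring M)); apply: eq_bigr => x _.
rewrite -{1}[a@_x]intz; exact: (raddfMz (mkmalgU x)).
Qed.

End MonoidRingCoefficients.

(** * Chains over the integers, with basis the [elem x A] *)

Section Chains.
Variables (M : monoidType) (K : choiceType).
Local Notation chain := (free_mod (ZM M) K).
Implicit Types (v w : chain) (x y : M) (A : K) (P Q : M -> K -> Prop).

Definition elem x A : chain := zmono x *: gen _ A.

Definition coef v x A : int := zcoef (coord v A) x.

Definition supported Q v := forall x A, coef v x A != 0 -> Q x A.

Lemma coefB v w x A : coef (v - w) x A = coef v x A - coef w x A.
Proof. by rewrite /coef coordB zcoefB. Qed.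

Lemma coef0 x A : coef 0 x A = 0.
Proof. by rewrite /coef coord0 zcoef0. Qed.

Lemma coef_elem x A y B : coef (elem x A) y B = ((x == y) && (A == B))%:R.
Proof.
rewrite /coef /elem coordZ coord_gen; have [_|_] := eqVneq A B.
  by rewrite andbT mulr1 zcoef_mono. rewrite andbF mulr0; exact: mcoeff0.
Qed.

Lemma scale_elem x y A : zmono x *: elem y A = elem (x * y)%g A.
Proof. by rewrite /elem scalerA zmonoM. Qed.

Lemma coef_eq0 v : (forall x A, coef v x A = 0) -> v = 0.
Proof.
move=> v0; apply: coordP => A; rewrite coord0.
by apply: zcoefP => x; rewrite zcoef0; apply: v0.
Qed.

Lemma supported0 Q : supported Q 0.
Proof. by move=> x A; rewrite coef0 eqxx. Qed.

Lemma supportedB Q v w : supported Q v -> supported Q w -> supported Q (v - w).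
Proof.
move=> Qv Qw x A; rewrite coefB.
have [->|/Qv//] := eqVneq (coef v x A) 0.
have [->|/Qw//] := eqVneq (coef w x A) 0.
by rewrite subr0 eqxx.
Qed.

Lemma supportedD Q v w : supported Q v -> supported Q w -> supported Q (v + w).
Proof.
move=> Qv Qw; rewrite -[w]opprK -[- w]sub0r; apply: supportedB Qv _.
by apply: supportedB Qw; apply: supported0.
Qed.

Lemma supported_elem Q x A : Q x A -> supported Q (elem x A).
Proof.
move=> QxA y B; rewrite coef_elem.
by have [<-|//] := eqVneq x y; have [<-|//] := eqVneq A B.
Qed.

Lemma supported_sub P Q v :
  (forall x A, P x A -> Q x A) -> supported P v -> supported Q v.
Proof. by move=> PQ Pv x A /Pv/PQ. Qed.

(** Integer multiples arise by repeated addition and negation, so closure of [S] under subtraction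
    is enough. Stability under [ZM M] is not asked, which permits properties such as being supported
    on irreducible elements. *)
Lemma supported_ind Q (S : chain -> Prop) v :
  S 0 -> (forall u w, S u -> S w -> S (u - w)) ->
  (forall x A, Q x A -> S (elem x A)) -> supported Q v -> S v.
Proof.
move=> S0 SB Se Qv.
have SN u : S u -> S (- u) by rewrite -sub0r; apply: SB.
have SD u w : S u -> S w -> S (u + w).
  by move=> Su Sw; rewrite -[w]opprK; apply: SB => //; apply: SN.
rewrite (@sum_gen _ _ v (csupp v)) ?csupp_uniq //; apply: big_ind => // A _.
rewrite [coord v A]sum_zmono scaler_suml; apply: big_ind => // x _.
rewrite -/(coef v x A); have [->|/Qv QxA] := eqVneq (coef v x A) 0.
  by rewrite mulr0z scale0r.
have Sn n : S (zmono x *+ n *: gen _ A).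
  elim: n => [|n IH]; first by rewrite mulr0n scale0r.
  by rewrite mulrS scalerDl; apply: SD; [apply: Se | apply: IH].
case: (coef v x A) => n; first exact: Sn.
by rewrite NegzE mulrNz scaleNr; apply: SN; apply: Sn.
Qed.

Lemma supportedZ P Q y v : (forall x A, P x A -> Q (y * x)%g A) ->
  supported P v -> supported Q (zmono y *: v).
Proof.
move=> PQ.
apply: (@supported_ind P (fun v => supported Q (zmono y *: v))).
- by rewrite scaler0; apply: supported0.
- by move=> u w Qu Qw; rewrite scalerBr; apply: supportedB.
- by move=> x A /PQ Q'; rewrite scale_elem; apply: supported_elem.
Qed.

Lemma supported_finite v :
  exists s : seq (M * K), supported (fun x A => (x, A) \in s) v.
Proof.
exists [seq (x, A) | A <- csupp v, x <- zsupp (coord v A)] => x A nz.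
apply/allpairsPdep; exists A, x; split=> //; last by rewrite mem_zsupp.
rewrite mem_csupp; apply: contraNneq nz => vA0.
by rewrite /coef vA0 zcoef0.
Qed.

End Chains.

(** Used to pick, in a nonzero chain, a term whose position is maximal. *)
Lemma seq_maximal (T : eqType) (R : T -> T -> Prop) (s : seq T) :
  (forall a, ~ R a a) -> (forall a b c, R a b -> R b c -> R a c) ->
  s != [::] -> exists2 a, a \in s & forall b, b \in s -> ~ R a b.
Proof.
move=> irr tr; elim: s => // a [|a' s] IH _.
  by exists a; rewrite ?mem_head // => b; rewrite inE => /eqP->.
have [//|b bs bmax] := IH.
have [Rba|nRba] := pselect (R b a).
  exists a; first exact: mem_head.
  move=> c; rewrite in_cons => /orP[/eqP->//|cs] Rac.
  exact: bmax cs (tr _ _ _ Rba Rac).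
exists b; first by rewrite in_cons bs orbT.
by move=> c; rewrite in_cons => /orP[/eqP->//|]; apply: bmax.
Qed.

(** * Extension of the complex by one step *)

Section Order.
Variable M : monoidType.
Implicit Types x y z : M.

Definition ldiv x y : Prop := exists z, y = (x * z)%g.

Definition divs_of y x : Prop := ldiv x y.

(** Positions are bounded by such sets so that one statement covers both the left divisors of a
    given element and the whole monoid. *)
Definition ldiv_closed (D : M -> Prop) : Prop :=
  forall x y, ldiv x y -> D y -> D x.

Lemma ldiv_refl x : ldiv x x.
Proof. by exists 1%g; rewrite mulg1. Qed.

Lemma ldiv_trans x y z : ldiv x y -> ldiv y z -> ldiv x z.
Proof. by move=> [u ->] [v ->]; exists (u * v)%g; rewrite mulgA. Qed.

Lemma ldiv_mul2l z x y : ldiv x y -> ldiv (z * x)%g (z * y)%g.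
Proof. by move=> [u ->]; exists u; rewrite mulgA. Qed.

Lemma ldiv_eqVproper x y : ldiv x y -> x = y \/ proper_left_divisor x y.
Proof.
move=> [u ->]; have [->|/eqP u1] := eqVneq u 1%g; first by left; rewrite mulg1.
by right; exists u.
Qed.

Lemma proper_ldiv x y : proper_left_divisor x y -> ldiv x y.
Proof. by move=> [u [_ ->]]; exists u. Qed.

Lemma proper_mul2l z x y :
  proper_left_divisor x y -> proper_left_divisor (z * x)%g (z * y)%g.
Proof. by move=> [u [u1 ->]]; exists u; rewrite mulgA. Qed.

End Order.

Section Step.
Variable M : monoidType.
Hypothesis plt_wf : well_founded (@proper_left_divisor M).
Hypothesis plt_trans : forall x y z : M,
  proper_left_divisor x y -> proper_left_divisor y z -> proper_left_divisor x z.

Definition within (K : choiceType) (L : K -> M) (D : M -> Prop)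
    (v : free_mod (ZM M) K) : Prop :=
  supported (fun x A => D (x * L A)%g) v.

(* That is: over the integers, the irreducible chains form a complement of
   [ker d], and the projection onto it along [ker d] does not raise positions. *)
Definition reduction (K : choiceType) (L : K -> M) (irr : M -> K -> Prop)
    (T : lmodType (ZM M))
    (d : {linear free_mod (ZM M) K -> T}) : Prop :=
  (forall D v, ldiv_closed D -> within L D v ->
     exists z, [/\ supported irr z, within L D z & d z = d v]) /\
  (forall z, supported irr z -> d z = 0 -> z = 0).

(** * Data matching the cells of two consecutive degrees *)

Variables (K0 K1 : choiceType) (L0 : K0 -> M) (L1 : K1 -> M).
Variables (irr0 : M -> K0 -> Prop) (irr1 : M -> K1 -> Prop).
Variables (tail : K1 -> K0) (q : K1 -> M).
Hypothesis L1E : forall B, L1 B = (q B * L0 (tail B))%g.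
Hypothesis irr0_mul : forall x A y B,
  irr0 x A -> (x * L0 A)%g = L1 B -> irr1 y B -> irr0 (y * x)%g A.
Hypothesis irr0_tail : forall y B, irr1 y B -> ~ irr0 (y * q B)%g (tail B).
Hypothesis irr1_ex : forall x A, ~ irr0 x A ->
  exists y B, [/\ irr1 y B, x = (y * q B)%g & A = tail B].
Hypothesis irr1_inj : forall y B y' B', irr1 y B -> irr1 y' B' ->
  (y * q B)%g = (y' * q B')%g -> tail B = tail B' -> y = y' /\ B = B'.

Local Notation R := (ZM M).

Variables (T : lmodType R) (d : {linear free_mod R K0 -> T}).
Hypothesis red : reduction L0 irr0 d.

Lemma boundary_step : exists d' : {linear free_mod R K1 -> free_mod R K0},
  [/\ reduction L1 irr1 d', forall w, d (d' w) = 0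
    & forall v, d v = 0 -> exists w, d' w = v].
Proof.
case: red => redE redI.
(* The reduction is applied with [D] the left divisors of [L1 B], which is itself the position of
   [elem (q B) (tail B)]. *)
have zP B : {z | [/\ supported irr0 z, within L0 (divs_of (L1 B)) z
    & d z = d (elem (q B) (tail B))]}.
  apply: cid; apply: redE; first by move=> x y; apply: ldiv_trans.
  by apply: supported_elem; rewrite -L1E; apply: ldiv_refl.
pose z B := sval (zP B).
have z_irr B : supported irr0 (z B) by rewrite /z; case: (zP B) => ? [].
have z_ldiv B : within L0 (divs_of (L1 B)) (z B).
  by rewrite /z; case: (zP B) => ? [].
have dz B : d (z B) = d (elem (q B) (tail B)).
  by rewrite /z; case: (zP B) => ? [].
pose d' : {linear free_mod R K1 -> free_mod R K0} :=
  free_lift (fun B => elem (q B) (tail B) - z B).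
have d'E y B : d' (elem y B) = elem (y * q B)%g (tail B) - zmono y *: z B.
  by rewrite /elem linearZ /= free_lift_gen scalerBr scale_elem.
have dd' w : d (d' w) = 0.
  apply: (@supported_ind _ _ (fun _ _ => True) (fun w => d (d' w) = 0)) => //.
  - by rewrite !linear0.
  - by move=> u v u0 v0; rewrite !linearB u0 v0 /= subr0.
  - move=> x B _; rewrite /elem linearZ /= free_lift_gen linearZ /= linearB /=.
    by rewrite dz subrr scaler0.
(* Terms of [z B] at position exactly [L1 B] stay irreducible by [irr0_mul]; the others stay
   properly below after left multiplication by [y]. *)
have yz_supp y B : irr1 y B -> supported (fun x A => irr0 x A \/
    proper_left_divisor (x * L0 A)%g (y * L1 B)%g) (zmono y *: z B).
  move=> yB; apply: (@supportedZ _ _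
    (fun x A => irr0 x A /\ ldiv (x * L0 A)%g (L1 B))).
    move=> x A [xA /ldiv_eqVproper[xAB|xAB]].
      by left; apply: irr0_mul xAB yB.
    by right; rewrite -mulgA; apply: proper_mul2l.
  by move=> x A nz; split; [apply: z_irr nz | apply: z_ldiv nz].
(* Modulo irreducible chains, [v] is the boundary of an irreducible chain with positions in [D]. *)
pose solved D v := exists w,
  [/\ supported irr1 w, within L1 D w & supported irr0 (v - d' w)].
have solved0 D : solved D 0.
  by exists 0; rewrite linear0 subr0; split; apply: supported0.
have solvedB D u v : solved D u -> solved D v -> solved D (u - v).
  move=> [w [? ? uw]] [w' [? ? vw']]; exists (w - w').
  split; [exact: supportedB | exact: supportedB |].
  have -> : u - v - d' (w - w') = (u - d' w) - (v - d' w').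
    by rewrite linearB /= !opprB addrACA [RHS]addrACA [- v - _]addrC.
  exact: supportedB.
have solved_sub (D D' : M -> Prop) v :
    (forall x, D x -> D' x) -> solved D v -> solved D' v.
  move=> DD' [w [w1 wD vw]]; exists w; split=> //.
  by apply: supported_sub wD => x A; apply: DD'.
have solved_elem m :
    forall x A, (x * L0 A)%g = m -> solved (divs_of m) (elem x A).
  (* Induction on the position: a reducible [elem x A] is matched with some [elem y B], and the
     reducible terms of [y * z B] lie properly below [m]. *)
  elim/(well_founded_ind plt_wf): m => m IH x A xAm.
  have [xA|/irr1_ex[y [B [yB xE AE]]]] := pselect (irr0 x A).
    exists 0; split; [exact: supported0 | exact: supported0 |].
    by rewrite linear0 subr0; apply: supported_elem.
  have yBm : (y * L1 B)%g = m by rewrite L1E mulgA -xE -AE.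
  have [w [w1 wm dw]] : solved (divs_of m) (zmono y *: z B).
    apply: supported_ind (yz_supp _ _ yB) => // [u v|x' A' [x'A'|]].
    - exact: solvedB.
    - exists 0; split; [exact: supported0 | exact: supported0 |].
      by rewrite linear0 subr0; apply: supported_elem.
    - rewrite yBm => lt_m; apply: (@solved_sub (divs_of (x' * L0 A')%g)).
        2: exact: IH lt_m _ _ erefl.
      by move=> t /ldiv_trans; apply; apply: proper_ldiv.
  (* As [d' (elem y B)] is [elem x A] minus [y * z B], and [w] solves [y * z B], the remainder is
     that of [w], hence irreducible. *)
  exists (elem y B + w); split.
  - by apply: supportedD w1; apply: supported_elem.
  - apply: supportedD wm; apply: supported_elem.
    by rewrite yBm; apply: ldiv_refl.
  - by rewrite linearD /= d'E -xE -AE opprD addrA subKr.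
have solvedP D v : ldiv_closed D -> within L0 D v -> solved D v.
  move=> Dc; apply: supported_ind => // [u w|x A xAD]; first exact: solvedB.
  by apply: solved_sub (solved_elem _ _ _ erefl) => y /Dc; apply.
(* The difference [v - d' w] is an irreducible cycle, so it vanishes by [redI]. *)
have solved_cycle v w : supported irr0 (v - d' w) -> d v = 0 -> d' w = v.
  move=> vw dv; apply/eqP; rewrite eq_sym -subr_eq0; apply/eqP.
  by apply: redI => //; rewrite linearB dv dd' subr0.
have d'_within D v : ldiv_closed D -> within L1 D v -> within L0 D (d' v).
  move=> Dc; apply: (@supported_ind _ _ (fun x B => D (x * L1 B)%g)
    (fun v => within L0 D (d' v))).
  - by rewrite linear0; apply: supported0.
  - by move=> u w Du Dw; rewrite linearB; apply: supportedB.
  - move=> x B xBD; rewrite d'E; apply: supportedB.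
      by apply: supported_elem; rewrite -mulgA -L1E.
    apply: supportedZ (z_ldiv B) => y A yAB; rewrite -mulgA.
    exact: Dc (ldiv_mul2l x yAB) xBD.
exists d'; split=> //; last first.
  move=> v dv; have [w [_ _ vw]] :=
    solvedP (fun _ => True) v (fun _ _ _ _ => I) (fun _ _ _ => I).
  by exists w; apply: solved_cycle.
split=> [D v Dc Dv|w w1 dw].
  have [w [w1 wD vw]] := solvedP D (d' v) Dc (d'_within D v Dc Dv).
  by exists w; split=> //; apply: solved_cycle.
(* A nonzero irreducible [w] with [d' w = 0] is excluded by its leading term: for [elem y B] of
   maximal position in [w], the coefficient of the matched element in [d' w] equals that of
   [elem y B] in [w]. *)
apply: coef_eq0 => x0 A0; apply/eqP/negPn/negP => nz0.
have [s ws] := supported_finite w.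
pose s' := [seq p <- s | coef w p.1 p.2 != 0].
have s'0 : s' != [::].
  have: (x0, A0) \in s' by rewrite mem_filter nz0 ws.
  by case: s'.
have plt_irr (m : M) : ~ proper_left_divisor m m.
  by elim: (plt_wf m) => {}m _ IH mm; apply: IH (mm) mm.
have [[y B]] := @seq_maximal _ (fun p p' : M * K1 =>
  proper_left_divisor (p.1 * L1 p.2)%g (p'.1 * L1 p'.2)%g) s'
  (fun p => plt_irr _) (fun p p' p'' => @plt_trans _ _ _) s'0.
rewrite mem_filter => /andP[/= yBw _] ymax.
have yB := w1 _ _ yBw.
suff: coef (d' w) (y * q B)%g (tail B) = coef w y B.
  by rewrite dw coef0 => /esym/eqP; apply/negP.
(* By maximality every term of [w] satisfies [Q], and the equality of coefficients can be checked on
   single terms. *)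
pose Q y' B' := irr1 y' B' /\
  ~ proper_left_divisor (y * L1 B)%g (y' * L1 B')%g.
apply: (@supported_ind _ _ Q
  (fun v => coef (d' v) (y * q B)%g (tail B) = coef v y B)).
- by rewrite linear0 !coef0.
- by move=> u v; rewrite linearB !coefB => -> ->.
- move=> y' B' [y'B' nlt]; rewrite d'E coefB !coef_elem.
  (* The matched element is reducible and its position [y * L1 B] is not properly below
     [y' * L1 B'], so [yz_supp] rules it out. *)
  have -> : coef (zmono y' *: z B') (y * q B)%g (tail B) = 0.
    apply/eqP/negPn/negP => /(yz_supp _ _ y'B')[|]; first exact: irr0_tail.
    by rewrite -mulgA -L1E.
  rewrite subr0; congr (nat_of_bool _)%:R; apply/andP/andP.
    by move=> [/eqP qq /eqP tt]; have [-> ->] := irr1_inj y'B' yB qq tt.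
  by move=> [/eqP-> /eqP->].
- move=> y' B' nz; split; first exact: w1.
  by apply: (ymax (y', B')); rewrite mem_filter /= nz ws.
Qed.

End Step.

(** * Admissible sequences *)

Section Gaussian.
Variables (M : monoidType) (X : M -> Prop) (lt : M -> M -> Prop).
Hypothesis gaussian : locally_left_Gaussian M.
Hypothesis X_gen : generates X.
Hypothesis lt_linear : linear_order_on X lt.
Hypothesis X1 : ~ X 1%g.
Hypothesis X_wo : forall x : M, well_ordered_by lt (right_divisors_in X x).
Implicit Types (x y z m a b : M) (s : seq M).

Lemma mulgI_r z x y : (x * z = y * z)%g -> x = y.
Proof. by case: gaussian => cancel _ _; apply: cancel. Qed.

(** If [y] were not 1, neither would [x] be, and [1, x, 1, x, ...] would be an infinite descent,
    since [1 = x * y] and [x = 1 * x]. *)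
Lemma mulg_eq1 x y : (x * y = 1)%g -> x = 1%g /\ y = 1%g.
Proof.
move=> xy1; have y1 : y = 1%g.
  case: gaussian => _ noeth _; apply: contrapT => ny1; apply: noeth.
  exists (fun i => if odd i then x else 1%g) => i /=; case: (odd i) => /=.
    exists x; rewrite mul1g; split=> // x1; apply: ny1.
    by rewrite -xy1 x1 mul1g.
  by exists y.
by split=> //; rewrite -xy1 y1 mulg1.
Qed.

Lemma proper_left_divisor_trans x y z : proper_left_divisor x y ->
  proper_left_divisor y z -> proper_left_divisor x z.
Proof.
move=> [u [u1 ->]] [v [v1 ->]]; exists (u * v)%g.
by rewrite mulgA; split=> // /mulg_eq1[].
Qed.

(** A non-accessible element has a non-accessible proper left divisor; choosing one repeatedly gives
    a forbidden infinite sequence. *)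
Lemma proper_left_divisor_wf : well_founded (@proper_left_divisor M).
Proof.
move=> x; apply: contrapT => nacc.
have next (p : {y | ~ Acc (@proper_left_divisor M) y}) :
    {p' : {y | ~ Acc (@proper_left_divisor M) y} |
     proper_left_divisor (sval p') (sval p)}.
  apply: cid; apply: contrapT => stuck; apply: (svalP p).
  constructor => y lt_y; apply: contrapT => nacc_y.
  by apply: stuck; exists (exist _ y nacc_y).
case: gaussian => _ noeth _; apply: noeth.
exists (fun i => sval (iter i (fun p => sval (next p)) (exist _ x nacc))).
by move=> i /=; apply: (svalP (next _)).
Qed.

Lemma right_divisor_trans x y z :
  right_divisor x y -> right_divisor y z -> right_divisor x z.
Proof. by move=> [u ->] [v ->]; exists (v * u)%g; rewrite mulgA. Qed.

Lemma right_divisor_mul z x y : right_divisor x y -> right_divisor x (z * y)%g.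
Proof. by move=> [u ->]; exists (z * u)%g; rewrite mulgA. Qed.

Lemma right_divisor_antisym x y :
  right_divisor x y -> right_divisor y x -> x = y.
Proof.
move=> [u yE] [v xE]; have [v1 _] : v = 1%g /\ u = 1%g.
  by apply: mulg_eq1; apply: (@mulgI_r x); rewrite mul1g -mulgA -yE -xE.
by rewrite xE v1 mul1g.
Qed.

(** * Left lcms and least right divisors *)

Definition left_lcm s : M :=
  if pselect (exists m, is_left_lcm s m) is left lcm_ex then sval (cid lcm_ex)
  else 1%g.

Lemma left_lcmP s m : is_left_lcm s m -> is_left_lcm s (left_lcm s).
Proof.
move=> s_m; rewrite /left_lcm.
case: pselect => [lcm_ex|]; last by case; exists m.
exact: svalP (cid lcm_ex).
Qed.

Lemma left_lcmE s m : is_left_lcm s m -> left_lcm s = m.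
Proof.
move=> s_m; have [cm lm] := left_lcmP s_m; have [cm' lm'] := s_m.
by apply: right_divisor_antisym; [apply: lm | apply: lm'].
Qed.

Lemma left_lcm_nil : is_left_lcm [::] (1%g : M).
Proof. by split=> // m _; exists m; rewrite mulg1. Qed.

(** The lcm of [a :: s] is that of [a] and [left_lcm s]; [m] witnesses the common left multiple that
    local lcms require. *)
Lemma left_lcm_cons a s m : is_left_lcm s (left_lcm s) ->
  right_divisor a m -> right_divisor (left_lcm s) m ->
  exists2 l, is_left_lcm (a :: s) l & right_divisor l m.
Proof.
move=> [s_l s_min] am sm; case: gaussian => _ _ lcm_ex.
have [|l [l_c l_min]] := lcm_ex a (left_lcm s).
  by exists m => x; rewrite !inE => /orP[/eqP->|/eqP->].
have la : right_divisor a l by apply: l_c; rewrite mem_head.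
have ls : right_divisor (left_lcm s) l by apply: l_c; rewrite !inE eqxx orbT.
exists l; last by apply: l_min => x; rewrite !inE => /orP[/eqP->|/eqP->].
split=> [x|m' m'_c].
  rewrite inE => /orP[/eqP->//|/s_l xs]; exact: right_divisor_trans xs ls.
apply: l_min => x; rewrite !inE => /orP[/eqP->|/eqP->].
  by apply: m'_c; rewrite mem_head.
by apply: s_min => y ys; apply: m'_c; rewrite inE ys orbT.
Qed.

Local Notation least_in m a := (is_least lt (right_divisors_in X m) a).

Lemma least_uniq m a b : least_in m a -> least_in m b -> a = b.
Proof.
case: lt_linear => irr tr _ [[Xa am] a_min] [[Xb bm] b_min].
have [//|ab] := a_min _ (conj Xb bm); have [//|ba] := b_min _ (conj Xa am).
by have := irr a Xa (tr _ _ _ Xa Xb Xa ab ba).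
Qed.

Lemma least_sub m m' a : right_divisor m' m -> right_divisor a m' ->
  least_in m a -> least_in m' a.
Proof.
move=> m'm am' [[Xa _] a_min]; split=> // b [Xb bm'].
by apply: a_min; split=> //; apply: right_divisor_trans bm' m'm.
Qed.

Lemma least_ex m a : X a -> right_divisor a m -> exists b, least_in m b.
Proof. by move=> Xa am; apply: (X_wo (x := m)) => //; exists a. Qed.

Lemma generator_ex x : x <> 1%g -> exists a, X a /\ right_divisor a x.
Proof.
have [s [sX ->]] := X_gen x.
case/lastP: s sX => [|s a] sX; first by rewrite big_nil.
move=> _; exists a; split; first by apply: sX; rewrite mem_rcons mem_head.
by rewrite -cats1 big_cat big_seq1; exists (\prod_(y <- s) y)%g.
Qed.

Local Notation adm := (admissible X lt).

Lemma admissible_lcm s : adm s -> is_left_lcm s (left_lcm s).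
Proof. by case=> _ _ [m] /left_lcmP. Qed.

Lemma admissible_nil : adm [::].
Proof.
by split=> // [i j|]; [rewrite andbF | exists 1%g; apply: left_lcm_nil].
Qed.

Lemma admissible_head a s : adm (a :: s) ->
  [/\ X a, forall b, b \in s -> lt a b & least_in (left_lcm (a :: s)) a].
Proof.
case=> sX incr _ lst; split; first by apply: sX; rewrite mem_head.
  move=> b bs; have := incr 0%N (index b s).+1.
  by rewrite /= nth_index //; apply; rewrite ltnS index_mem.
have [m [lm lst_m]] := lst 0%N isT.
by rewrite (left_lcmE lm).
Qed.

Lemma admissible_tail a s : adm (a :: s) -> adm s.
Proof.
case=> sX incr _ lst; split.
- by move=> x xs; apply: sX; rewrite inE xs orbT.
- by move=> i j ij; apply: (incr i.+1 j.+1).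
(* The conditions on suffixes concern nonempty ones only, so the empty tail, with lcm 1, is treated
   apart. *)
- case: s lst {sX incr} => [_|b s lst]; first by exists 1%g; apply: left_lcm_nil.
  by have [m [lm _]] := lst 1%N isT; exists m; rewrite drop1 in lm.
- by move=> i i_s; apply: (lst i.+1).
Qed.

Lemma admissible_cons a s m : X a -> adm s -> (forall b, b \in s -> lt a b) ->
  is_left_lcm (a :: s) m -> least_in m a -> adm (a :: s).
Proof.
move=> Xa [sX incr _ lst] a_s lm lst_m; split.
- by move=> x; rewrite inE => /orP[/eqP->//|/sX].
- move=> [|i] [|j] //= ij; last exact: incr.
  by apply: a_s; apply: mem_nth.
- by exists m.
- by move=> [|i] i_s; [exists m | apply: lst].
Qed.

Lemma right_divisor_lcm s x : adm s -> x \in s -> right_divisor x (left_lcm s).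
Proof. by move=> /admissible_lcm[c _]; apply: c. Qed.

Lemma right_divisor_lcm_tail a s : adm (a :: s) ->
  right_divisor (left_lcm s) (left_lcm (a :: s)).
Proof.
move=> as_adm; have [c _] := admissible_lcm as_adm.
have [_ lm] := admissible_lcm (admissible_tail as_adm).
by apply: lm => x xs; apply: c; rewrite inE xs orbT.
Qed.

Lemma admissible_lcm_neq1 a s : adm (a :: s) -> left_lcm (a :: s) <> 1%g.
Proof.
move=> as_adm as1; have [Xa _ _] := admissible_head as_adm; apply: X1.
have [u] := right_divisor_lcm as_adm (mem_head a s).
by rewrite as1 => /esym/mulg_eq1[_ a1]; rewrite -a1.
Qed.

(** * Cells, irreducible elements and their matching *)

Definition cell k := {s : seq M | `[< adm s /\ size s = k >]}.

HB.instance Definition _ k := Choice.on (cell k).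

Lemma cell_adm k (A : cell k) : adm (val A).
Proof. by case: A => s /= /asboolP[]. Qed.

Lemma cell_size k (A : cell k) : size (val A) = k.
Proof. by case: A => s /= /asboolP[]. Qed.

Lemma behead_cell k (B : cell k.+1) :
  `[< adm (behead (val B)) /\ size (behead (val B)) = k >].
Proof.
case: B => -[|b s] /= /asboolP[// s_adm [sk]]; apply/asboolP.
by split=> //; apply: admissible_tail s_adm.
Qed.

Definition cell_tail k (B : cell k.+1) : cell k :=
  exist _ (behead (val B)) (behead_cell B).

Definition cell_lcm k (A : cell k) : M := left_lcm (val A).

Lemma cell_quotient_ex k (B : cell k.+1) :
  exists q, cell_lcm B = (q * cell_lcm (cell_tail B))%g.
Proof.
rewrite /cell_lcm -[val (cell_tail B)]/(behead (val B)).
have := cell_adm B; have := cell_size B.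
by case: (val B) => //= b s _ /right_divisor_lcm_tail.
Qed.

(* The paper's alpha_{/A}, for [B = alpha :: A]. *)
Definition cell_quotient k (B : cell k.+1) : M := sval (cid (cell_quotient_ex B)).

Lemma cell_quotientE k (B : cell k.+1) :
  cell_lcm B = (cell_quotient B * cell_lcm (cell_tail B))%g.
Proof. exact: svalP (cid (cell_quotient_ex B)). Qed.

Definition irreducible k x (A : cell k) : Prop :=
  if val A is a :: _ then least_in (x * cell_lcm A)%g a else x = 1%g.

Lemma cell_lcm0 (A : cell 0) : cell_lcm A = 1%g.
Proof.
by rewrite /cell_lcm (size0nil (cell_size A)); apply/left_lcmE/left_lcm_nil.
Qed.

Lemma cellP k (B : cell k.+1) : exists b,
  [/\ val B = b :: val (cell_tail B), least_in (cell_lcm B) b,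
      forall c, c \in val (cell_tail B) -> lt b c & X b].
Proof.
rewrite /cell_lcm -[val (cell_tail B)]/(behead (val B)).
have := cell_size B; have := cell_adm B.
by case: (val B) => //= b s /admissible_head[]; exists b.
Qed.

Lemma irreducible_cons k x (B : cell k.+1) b s : val B = b :: s ->
  irreducible x B = least_in (x * cell_lcm B)%g b.
Proof. by rewrite /irreducible => ->. Qed.

(** The head of [A] is the least generator dividing [cell_lcm B], so it is the head of [B], which
    stays least at [y * cell_lcm B]. If [A] is empty, [x = 1] would force [cell_lcm B = 1]. *)
Lemma irreducible_mul k x (A : cell k) y (B : cell k.+1) :
  irreducible x A -> (x * cell_lcm A)%g = cell_lcm B -> irreducible y B ->
  irreducible (y * x)%g A.
Proof.
have [b [BE lst_b _ _]] := cellP B; rewrite (irreducible_cons _ BE).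
have nB1 : cell_lcm B <> 1%g.
  by have := cell_adm B; rewrite /cell_lcm BE; apply: admissible_lcm_neq1.
rewrite /irreducible; have := cell_adm A; case AE: (val A) => [|a s] A_adm.
  move=> -> AB; case: nB1; rewrite -AB /cell_lcm AE mul1g.
  exact/left_lcmE/left_lcm_nil.
by move=> + AB; rewrite AB -mulgA AB => /least_uniq/(_ lst_b)->.
Qed.

(** The position is still [y * cell_lcm B], where the head of [B] is least, and it is strictly
    smaller than the head of the tail. With an empty tail, a trivial product would force
    [cell_lcm B = 1]. *)
Lemma irreducible_tail k y (B : cell k.+1) :
  irreducible y B -> ~ irreducible (y * cell_quotient B)%g (cell_tail B).
Proof.
have [b [BE _ lt_b Xb]] := cellP B; rewrite (irreducible_cons _ BE) => lst_b.
rewrite /irreducible -mulgA -cell_quotientE.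
case AE: (val (cell_tail B)) => [|c s].
  case/mulg_eq1=> _ q1; have := cell_adm B; rewrite BE AE.
  move/admissible_lcm_neq1; apply; rewrite -AE -BE -/(cell_lcm B).
  rewrite cell_quotientE q1 mul1g /cell_lcm AE.
  exact/left_lcmE/left_lcm_nil.
move/(least_uniq lst_b) => bc; case: lt_linear => irr _ _; apply: (irr b) => //.
by rewrite {2}bc; apply: lt_b; rewrite AE mem_head.
Qed.

(** The product and the tail determine the position; its least generator is the common head, and
    right cancellation recovers [y]. *)
Lemma irreducible_inj k y (B : cell k.+1) y' (B' : cell k.+1) :
  irreducible y B -> irreducible y' B' ->
  (y * cell_quotient B)%g = (y' * cell_quotient B')%g ->
  cell_tail B = cell_tail B' -> y = y' /\ B = B'.
Proof.
have [b [BE _ _ _]] := cellP B; have [b' [BE' _ _ _]] := cellP B'.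
rewrite (irreducible_cons _ BE) (irreducible_cons _ BE') => lst_b lst_b' qq tt.
have yLB : (y * cell_lcm B)%g = (y' * cell_lcm B')%g.
  by rewrite !cell_quotientE !mulgA qq tt.
have BB' : B = B'.
  apply: val_inj; rewrite BE BE' tt; congr (_ :: _).
  by apply: least_uniq lst_b _; rewrite yLB.
by split=> //; apply: (@mulgI_r (cell_lcm B)); rewrite yLB BB'.
Qed.

(** The least generator [mu] dividing the position is prepended. It precedes the head of [A], which
    divides the position without being least; for empty [A] it exists because [x] is not 1. *)
Lemma irreducible_ex k x (A : cell k) : ~ irreducible x A ->
  exists y (B : cell k.+1),
    [/\ irreducible y B, x = (y * cell_quotient B)%g & A = cell_tail B].
Proof.
move=> red_x; pose m := (x * cell_lcm A)%g.
have [mu [lst_mu lt_mu]] :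
    exists mu, least_in m mu /\ forall b, b \in val A -> lt mu b.
  move: red_x; rewrite /irreducible -/m; have A_adm := cell_adm A.
  have Am b : b \in val A -> right_divisor b m.
    by move=> bA; apply: right_divisor_mul; apply: right_divisor_lcm bA.
  case AE: (val A) => [|a s] in A_adm Am *.
    move=> x1; have [a [Xa ax]] := generator_ex x1.
    have [|mu lst_mu] := least_ex (m := m) Xa; last by exists mu.
    by rewrite /m /cell_lcm AE (left_lcmE left_lcm_nil) mulg1.
  move=> not_lst; have [Xa lt_a lst_a] := admissible_head A_adm.
  have am := Am _ (mem_head a s).
  have [mu lst_mu] := least_ex Xa am; exists mu; split=> // b.
  have lt_mua : lt mu a.
    have [_ mu_min] := lst_mu; have [amu|//] := mu_min _ (conj Xa am).
    by case: not_lst; rewrite amu.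
  rewrite inE => /orP[/eqP->//|bs]; case: lt_linear => _ tr _.
  have [sX _ _ _] := A_adm; have [[Xmu _] _] := lst_mu.
  by apply: (tr _ a) => //; [apply: sX; rewrite inE bs orbT | apply: lt_a].
have [[Xmu mu_m] mu_min] := lst_mu.
have Am : right_divisor (left_lcm (val A)) m by exists x.
have [l l_lcm [y lm]] := left_lcm_cons (admissible_lcm (cell_adm A)) mu_m Am.
(* Being least among the divisors of [m], [mu] is least among the fewer divisors of [l]. *)
have lst_l : least_in l mu.
  apply: least_sub lst_mu; first by exists y.
  by have [c _] := l_lcm; apply: c; rewrite mem_head.
have muA_adm := admissible_cons Xmu (cell_adm A) lt_mu l_lcm lst_l.
have muA_cell : `[< adm (mu :: val A) /\ size (mu :: val A) = k.+1 >].
  by apply/asboolP; split=> //=; rewrite cell_size.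
pose B : cell k.+1 := exist _ (mu :: val A) muA_cell.
have tailB : cell_tail B = A by apply: val_inj.
have lcmB : cell_lcm B = l by apply: left_lcmE.
exists y, B; split=> //.
  by rewrite (@irreducible_cons _ _ _ mu (val A)) // lcmB -lm.
apply: (@mulgI_r (cell_lcm A)).
by rewrite -/m lm -lcmB cell_quotientE tailB mulgA.
Qed.

End Gaussian.

(** * The order resolution *)

Section Resolution.
Variables (M : monoidType) (X : M -> Prop) (lt : M -> M -> Prop).
Hypothesis gaussian : locally_left_Gaussian M.
Hypothesis X_gen : generates X.
Hypothesis lt_linear : linear_order_on X lt.
Hypothesis X1 : ~ X 1%g.
Hypothesis X_wo : forall x : M, well_ordered_by lt (right_divisors_in X x).

Local Notation chain k := (free_mod (ZM M) (cell X lt k)).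
Local Notation red k d :=
  (reduction (@cell_lcm M X lt k) (@irreducible M X lt k) d).

Definition trivial_mod : lmodType (ZM M) := trivial_Z M.

Definition chain_augmentation : {linear chain 0 -> trivial_mod} :=
  free_lift (fun _ : cell X lt 0 => (1%Z : trivial_mod)).

Lemma chain_augmentation_elem x (A : cell X lt 0) :
  chain_augmentation (elem x A) = 1%Z :> int.
Proof.
by rewrite /elem linearZ /= free_lift_gen; apply: (@trivial_ZE M x (1%Z : trivial_Z M)).
Qed.

Definition empty_cell : cell X lt 0.
Proof. by exists [::]; apply/asboolP; split=> //; apply: admissible_nil. Defined.

Lemma cell0_eq (A : cell X lt 0) : A = empty_cell.
Proof. by apply: val_inj; apply: size0nil (cell_size A). Qed.

(** Irreducible 0-chains are the integer multiples of [elem 1 empty_cell]. Replacing each [elem x A]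
    by it keeps the augmentation, and 1 left-divides every position. *)
Lemma reduction_augmentation : red 0 chain_augmentation.
Proof.
split=> [D v Dc|z].
  apply: (@supported_ind _ _ _ (fun v => exists z,
    [/\ supported (@irreducible M X lt 0) z, within (@cell_lcm M X lt 0) D z
      & chain_augmentation z = chain_augmentation v])).
  - by exists 0; split=> //; apply: supported0.
  - move=> u w [z [zi zD zu]] [z' [zi' zD' zw]]; exists (z - z').
    by split; [apply: supportedB | apply: supportedB | rewrite !linearB zu zw].
  - move=> x A xAD; exists (elem 1%g A); split.
    + by apply: supported_elem; rewrite /irreducible (size0nil (cell_size A)).
    + apply: supported_elem; rewrite cell_lcm0 // mulg1.
      by apply: Dc xAD; exists (x * cell_lcm A)%g; rewrite mul1g.
    + by rewrite !chain_augmentation_elem.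
move=> zi; have [c ->] : exists c : int, z = elem 1%g empty_cell *~ c.
  move: zi; apply: (@supported_ind _ _ _
    (fun z => exists c : int, z = elem 1%g empty_cell *~ c)).
  - by exists 0; rewrite mulr0z.
  - by move=> u w [c ->] [c' ->]; exists (c - c'); rewrite mulrzBr.
  - move=> x A; rewrite /irreducible (size0nil (cell_size A)) => ->.
    by exists 1; rewrite mulr1z (cell0_eq A).
rewrite raddfMz /= => c0; suff -> : c = 0 by rewrite mulr0z.
rewrite -[c]intz -c0; congr (_ *~ c).
exact/esym/chain_augmentation_elem.
Qed.

Lemma chain_step k (T : lmodType (ZM M)) (d : {linear chain k -> T}) :
  red k d ->
  {d' : {linear chain k.+1 -> chain k} |
   [/\ red k.+1 d', forall w, d (d' w) = 0
     & forall v, d v = 0 -> exists w, d' w = v]}.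
Proof.
move=> red_d; apply: cid.
apply: (boundary_step _ _ (@cell_quotientE M X lt k)
  (@irreducible_mul M X lt gaussian lt_linear X1 k)
  (@irreducible_tail M X lt gaussian lt_linear X1 k)
  (@irreducible_ex M X lt gaussian X_gen lt_linear X_wo k)
  (@irreducible_inj M X lt gaussian lt_linear k) red_d).
- exact: proper_left_divisor_wf.
- exact: proper_left_divisor_trans.
Qed.

(** Only the reduction is carried along, as the next step needs it; exactness is read off later from
    the same [chain_step]. *)
Fixpoint boundaries k : {d : {linear chain k.+1 -> chain k} | red k.+1 d} :=
  match k with
  | 0 => let: exist d dP := chain_step reduction_augmentation in
         exist _ d (let: And3 r _ _ := dP in r)
  | k'.+1 => let: exist d dP := chain_step (svalP (boundaries k')) in
         exist _ d (let: And3 r _ _ := dP in r)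
  end.

Lemma order_resolution n (P : lmodType (ZM M) -> Prop) :
  (forall s, admissible X lt s -> (size s <= n)%N) ->
  (forall k, (k <= n)%N -> P (chain k)) ->
  @Z_resolution M P n.
Proof.
move=> s_n PC.
exists (fun k => chain k), (fun k => sval (boundaries k)), chain_augmentation.
split.
- exact: PC.
(* Beyond degree [n] there is no cell, hence no coordinate on which [v] could differ from 0. *)
- move=> k nk v; apply: coordP => A; case/negP: (ltnn n).
  by apply: leq_trans nk _; rewrite -(cell_size A); apply: s_n; apply: cell_adm.
- move=> m; exists (elem 1%g empty_cell *~ (m : int)).
  rewrite raddfMz /=; apply: etrans (intz m); congr (_ *~ m).
  exact: chain_augmentation_elem.
- move=> v /=; case: (chain_step _) => d [r dd0 ex] /=; split; first exact: ex.
  by move=> [w <-]; apply: dd0.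
- move=> k v /=; case: (chain_step (svalP (boundaries k))) => d [r dd0 ex] /=.
  by split; [apply: ex | move=> [w <-]; apply: dd0].
Qed.

End Resolution.

(** * The resolution of length [n], with finite ranks when there are finitely many admissible
    sequences *)

Theorem proposition3p9 (M : monoidType) (X : M -> Prop) (lt : M -> M -> Prop)
    (n : nat) :
  locally_left_Gaussian M ->
  generates X ->
  linear_order_on X lt ->
  ~ X 1%g ->
  (forall x : M, well_ordered_by lt (right_divisors_in X x)) ->
  is_max_size (admissible X lt) n ->
  [/\ free_resolution M n,
      type_FL M
    & finitely_many (admissible X lt) -> fg_free_resolution M n /\ type_FL_fg M].
Proof.
move=> gaussian X_gen lt_linear X1 X_wo [_ s_n].
have res P : (forall k, (k <= n)%N -> P (free_mod (ZM M) (cell X lt k))) ->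
    @Z_resolution M P n.
  by move=> PC; apply: (order_resolution gaussian X_gen lt_linear X1 X_wo s_n).
have free : free_resolution M n.
  by apply: res => k _; eexists; apply: gen_basis.
split; [exact: free | by exists n |].
move=> [ss ss_adm].
have fg : fg_free_resolution M n; last by split=> //; exists n.
(* [pmap insub] keeps from [ss] exactly the admissible sequences of length [k], viewed as cells. *)
apply: res => k _; pose cells : seq (cell X lt k) := pmap insub ss.
exists [seq gen (ZM M) A | A <- cells].
apply: is_basis_ext (gen_basis (ZM M) (cell X lt k)) => v.
split=> [[A ->]|/mapP[A _ ->]]; last by exists A.
by apply: map_f; rewrite mem_pmap_sub; apply: ss_adm; apply: cell_adm.
Qed.
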